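(* Let $\beta<0$, $\kappa>0$ and $K\neq0$ be real constants and let $I=\{r>0:1-Kr>0\}$. Set $\mathcal{A}(\psi)\equiv1$, $\tilde{\mathcal{C}}(\psi)=\sqrt{-\tfrac{2\beta}{3}}\,\psi$, $\mathcal{V}\equiv0$, and $$A(r)=1-Kr,\qquad C(r)=1,\qquad \psi(r)=\sqrt{-\tfrac{6}{\beta}}\,\log(1-Kr).$$ Then $E^{(1)}_{tt}=E^{(1)}_{rr}=E^{(1)}_{\vartheta\vartheta}=E^{(1)}_{\psi}=0$ hold on $I$, i.e. this is a solution of the real-tetrad vacuum field equations with metric ${\rm d}s^2=(1-Kr)^2{\rm d}t^2-(1-Kr)^{-2}{\rm d}r^2-r^2{\rm d}\Omega^2$.
   Context: Metric ansatz ${\rm d}s^2=A(r)^2{\rm d}t^2-\frac{C(r)^2}{A(r)^2}{\rm d}r^2-r^2{\rm d}\Omega^2$, $\psi=\psi(r)$. Primes on $A,C,\psi$ are $r$-derivatives; $\mathcal{A}',\tilde{\mathcal{C}}',\tilde{\mathcal{C}}'',\mathcal{V}'$ are $\psi$-derivatives evaluated at $\psi(r)$. The real-tetrad reduced vacuum field equations of the scalar-torsion theory are: $E^{(1)}_{tt}:\ 0=\mathcal{A}\frac{A^2(-2rACA'-A^2(C-2rC')+C^3)}{r^2C^3}+\tilde{\mathcal{C}}'\Big(\frac{A^4\psi''}{C^2}-\frac{A^3\psi'(-rCA'+rAC'-2C^2)}{rC^3}\Big)-\frac{2A^3(A-C)\psi'\mathcal{A}'}{rC^2}+\frac{A^4\psi'^2\tilde{\mathcal{C}}''}{C^2}-\frac{\beta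 A^4\psi'^2}{2C^2}+\kappa^2A^2\mathcal{V}$; $E^{(1)}_{rr}:\ 0=-\frac{(2rAA'+A^2-C^2)\mathcal{A}}{r^2A^2}+\big(\frac{A'}{A}+\frac2r\big)\psi'\tilde{\mathcal{C}}'+\frac{\kappa^2C^2\mathcal{V}}{A^2}+\frac12\beta\psi'^2$; $E^{(1)}_{\vartheta\vartheta}:\ 0=-\frac{A\psi'(rA'+A-C)\mathcal{A}'}{rC^2}+\tilde{\mathcal{C}}'\Big(\frac{A\psi'(rCA'-rAC'+C^2)}{rC^3}+\frac{A^2\psi''}{C^2}\Big)+\frac{\mathcal{A}(-rCA'^2+A(rA'C'-C(rA''+2A'))+A^2C')}{rC^3}+\frac{A^2\psi'^2\tilde{\mathcal{C}}''}{C^2}-\frac{\beta A^2\psi'^2}{2C^2}+\kappa^2\mathcal{V}$; $E^{(1)}_{\psi}:\ 0=\frac{(A-C)(2rA'+A-C)\mathcal{A}'}{r^2C^2}+\frac{\beta A\psi'(2rCA'+A(2C-rC'))}{rC^3}+\frac{\beta A^2\psi''}{C^2}+\kappa^2\mathcal{V}'+\frac{\tilde{\mathcal{C}}'(rCA'(rA'-2C)+A(-r^2A'C'+rC(rA''+6A')-2C^2)+2A^2(C-rC'))}{r^2C^3}$. *)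

(* Defs.v *)
From Stdlib Require Import Reals.
From Coquelicot Require Import Coquelicot.
Open Scope R_scope.

(* The reduced real-tetrad vacuum field equations of the scalar-torsion
   theory, for the ansatz ds^2 = A^2 dt^2 - C^2/A^2 dr^2 - r^2 dOmega^2,
   psi = psi(r).  [cA], [cC], [cV] are the coupling functions
   \mathcal{A}, \tilde{\mathcal{C}}, \mathcal{V} of psi; primes on them
   are psi-derivatives evaluated at psi(r); primes on A, C, psi are
   r-derivatives. *)

Section FieldEqs.
Variables (beta kappa : R) (cA cC cV A C psi : R -> R) (r : R).

Let a := A r.
Let a1 := Derive A r.
Let a2 := Derive (Derive A) r.
Let c := C r.
Let c1 := Derive C r.
Let p1 := Derive psi r.
Let p2 := Derive (Derive psi) r.
Let fA := cA (psi r).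
Let fA1 := Derive cA (psi r).
Let fC1 := Derive cC (psi r).
Let fC2 := Derive (Derive cC) (psi r).
Let fV := cV (psi r).
Let fV1 := Derive cV (psi r).

Definition E_tt : R :=
  fA * (a^2 * (-2 * r * a * c * a1 - a^2 * (c - 2 * r * c1) + c^3)) / (r^2 * c^3)
  + fC1 * (a^4 * p2 / c^2
           - a^3 * p1 * (- r * c * a1 + r * a * c1 - 2 * c^2) / (r * c^3))
  - 2 * a^3 * (a - c) * p1 * fA1 / (r * c^2)
  + a^4 * p1^2 * fC2 / c^2
  - beta * a^4 * p1^2 / (2 * c^2)
  + kappa^2 * a^2 * fV.

Definition E_rr : R :=
  - (2 * r * a * a1 + a^2 - c^2) * fA / (r^2 * a^2)
  + (a1 / a + 2 / r) * p1 * fC1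
  + kappa^2 * c^2 * fV / a^2
  + / 2 * beta * p1^2.

Definition E_thth : R :=
  - a * p1 * (r * a1 + a - c) * fA1 / (r * c^2)
  + fC1 * (a * p1 * (r * c * a1 - r * a * c1 + c^2) / (r * c^3)
           + a^2 * p2 / c^2)
  + fA * (- r * c * a1^2 + a * (r * a1 * c1 - c * (r * a2 + 2 * a1)) + a^2 * c1)
      / (r * c^3)
  + a^2 * p1^2 * fC2 / c^2
  - beta * a^2 * p1^2 / (2 * c^2)
  + kappa^2 * fV.

Definition E_psi : R :=
  (a - c) * (2 * r * a1 + a - c) * fA1 / (r^2 * c^2)
  + beta * a * p1 * (2 * r * c * a1 + a * (2 * c - r * c1)) / (r * c^3)
  + beta * a^2 * p2 / c^2
  + kappa^2 * fV1
  + fC1 * (r * c * a1 * (r * a1 - 2 * c)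
           + a * (- r^2 * a1 * c1 + r * c * (r * a2 + 6 * a1) - 2 * c^2)
           + 2 * a^2 * (c - r * c1)) / (r^2 * c^3).

End FieldEqs.

(* Main.v *)
Require Import Defs.
From Stdlib Require Import Reals Lra.
From Coquelicot Require Import Coquelicot.
Open Scope R_scope.

(* With [A = 1 - K r] and [C = 1] one has [A'' = 0], and [psi = s ln A] gives
   [psi' = - s K / A], [psi'' = - s K^2 / A^2].  The couplings are tuned so that,
   writing [q] for the slope of [cC], [q s = 2] and [beta s^2 = -6]; once
   [q] and [beta] are eliminated in favour of [s], each field equation becomes a
   rational identity in [r], [K] and [s], valid wherever [r] and [A] are nonzero. *)

Lemma locally_pos (f : R -> R) (x : R) :
  continuous f x -> 0 < f x -> locally x (fun y => 0 < f y).
Proof. intros Hf Hpos. exact (Hf _ (open_gt 0 (f x) Hpos)). Qed.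

Lemma Derive_Derive_const (f : R -> R) (c t : R) :
  (forall x, Derive f x = c) -> Derive (Derive f) t = 0.
Proof. intros Hf. rewrite (Derive_ext _ (fun _ => c)) by exact Hf. apply Derive_const. Qed.

Lemma Derive_scal_id (q x : R) : Derive (fun p => q * p) x = q.
Proof. apply is_derive_unique. auto_derive; [easy | ring]. Qed.

Lemma Derive_affine (a b t : R) : Derive (fun x => a - b * x) t = - b.
Proof. apply is_derive_unique. auto_derive; [easy | ring]. Qed.

Lemma Derive_scal_ln_affine (s K t : R) : 0 < 1 - K * t ->
  Derive (fun r => s * ln (1 - K * r)) t = - s * K / (1 - K * t).
Proof. intros Ht. apply is_derive_unique. auto_derive; [lra | field; lra]. Qed.

(* [ln] is only differentiable where its argument is positive, so the first
   derivative is known in closed form merely on a neighbourhood of [t]. *)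
Lemma Derive_Derive_scal_ln_affine (s K t : R) : 0 < 1 - K * t ->
  Derive (Derive (fun r => s * ln (1 - K * r))) t = - s * K ^ 2 / (1 - K * t) ^ 2.
Proof.
  intros Ht.
  assert (Hloc : locally t (fun y => 0 < 1 - K * y)).
  { apply locally_pos; [| exact Ht].
    apply (ex_derive_continuous (fun y => 1 - K * y)). auto_derive. easy. }
  rewrite (Derive_ext_loc _ (fun r => - s * K / (1 - K * r))).
  - apply is_derive_unique. auto_derive; [lra | field; lra].
  - apply (filter_imp _ _ (fun y => Derive_scal_ln_affine s K y) Hloc).
Qed.

Lemma opp_div_neg_pos (a beta : R) : 0 < a -> beta < 0 -> 0 < - (a / beta).
Proof.
  intros Ha Hb. replace (- (a / beta)) with (a / - beta) by (field; lra).
  apply Rdiv_lt_0_compat; lra.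
Qed.

Lemma sqrt_mul_sqrt_coupling (beta : R) : beta < 0 ->
  sqrt (- (2 * beta / 3)) * sqrt (- (6 / beta)) = 2.
Proof.
  intros Hb.
  pose proof (opp_div_neg_pos 6 beta ltac:(lra) Hb).
  rewrite <- sqrt_mult by lra.
  replace (- (2 * beta / 3) * - (6 / beta)) with (2 * 2) by (field; lra).
  apply sqrt_square. lra.
Qed.

Theorem mainTheorem3 (beta kappa K : R) :
  beta < 0 -> kappa > 0 -> K <> 0 ->
  let cA := fun _ : R => 1 in
  let cC := fun p : R => sqrt (- (2 * beta / 3)) * p in
  let cV := fun _ : R => 0 in
  let A := fun r : R => 1 - K * r in
  let C := fun _ : R => 1 in
  let psi := fun r : R => sqrt (- (6 / beta)) * ln (1 - K * r) in
  forall r : R, 0 < r -> 0 < 1 - K * r ->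
    E_tt beta kappa cA cC cV A C psi r = 0 /\
    E_rr beta kappa cA cC cV A C psi r = 0 /\
    E_thth beta kappa cA cC cV A C psi r = 0 /\
    E_psi beta kappa cA cC cV A C psi r = 0.
Proof.
  intros Hb _ _ cA cC cV A C psi r Hr HA.
  pose proof (opp_div_neg_pos 6 beta ltac:(lra) Hb) as H6.
  pose proof (sqrt_lt_R0 _ H6) as Hs.
  pose proof (sqrt_sqrt _ (Rlt_le _ _ H6)) as Hss.
  pose proof (sqrt_mul_sqrt_coupling beta Hb) as Hqs.
  set (s := sqrt (- (6 / beta))) in *.
  set (q := sqrt (- (2 * beta / 3))) in *.
  subst cA cC cV A C psi.
  unfold E_tt, E_rr, E_thth, E_psi.
  rewrite !Derive_const, !Derive_affine, !Derive_scal_id,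
    !Derive_scal_ln_affine, !Derive_Derive_scal_ln_affine by exact HA.
  rewrite !(Derive_Derive_const (fun x => 1 - K * x) (- K)) by apply Derive_affine.
  rewrite !(Derive_Derive_const (fun p => q * p) q) by apply Derive_scal_id.
  replace q with (2 / s) by (rewrite <- Hqs; field; lra).
  replace beta with (- 6 / (s * s)) by (rewrite Hss; field; lra).
  repeat split; field; repeat split; lra.
Qed.
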